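(* (a) There is a constant $C$ such that, for every nonempty finite set $E$ with even cardinality, every increasing event $A \subset \{0,1\}^E$ (with $A\neq\emptyset$, $A\neq\{0,1\}^E$), and every decision tree $T$ on $E$, writing $k=|E|/2$, $$P_{k,E}(A)\,\bigl(1 - P_{k,E}(A)\bigr) \;\leq\; C \left( \sum_{e \in E} I(e)\, \delta_e + \sum_{e \in E} I(e)\, \bar{\delta} \right),$$ where $I(e)=I^A_{k,E}(e)$, $\delta_e=\delta_e(A,T)$ is the revealment probability of $e$ under $P_{k,E}$, and $\bar\delta=\bar\delta(A,T)=\frac{1}{|E|}\sum_{e\in E}\delta_e(A,T)$. Moreover, if $|E|\geq 10$, this inequality holds with $C=20$. (b) More generally, for every $\varepsilon \in (0,1/2]$ there is a constant $C(\varepsilon)$ such that for all positive integers $n$, all sets $E$ with $|E|=n$, all integers $k \in [\varepsilon n, (1-\varepsilon) n]$, all increasing events $A \subset \{0,1\}^E$ (with $A\neq\emptyset$, $A\neq\{0,1\}^E$) and all decision trees $T$ on $E$, $$P_{k,E}(A)\,\bigl(1 - P_{k,E}(A)\bigr) \;\leq\; C(\varepsilon) \left( \sum_{e \in E} I(e)\, \delta_e + \sum_{e \in E} I(e)\, \bar{\delta} \right),$$ with $I(e)=I^A_{k,E}(e)$, $\delta_e=\delta_e(A,T)$ (computed under $P_{k,E}$) and $\bar\delta=\frac{1}{n}\sum_{e\in E}\delta_e$.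
   Context: Let $E$ be a finite set, $n=|E|$, and $0\le k\leq n$. For $\omega\in\{0,1\}^E$ write $|\omega|=\sum_{e\in E}\omega_e$. $P_{k,E}$ is the probability distribution on $\{0,1\}^E$ with $P_{k,E}(\omega)=1/\binom{|E|}{k}$ if $|\omega|=k$ and $P_{k,E}(\omega)=0$ otherwise. An event is a subset $A\subset\{0,1\}^E$; it is assumed throughout that $A\neq\emptyset$ and $A\neq\{0,1\}^E$. $I_A$ denotes the indicator function of $A$. $A$ is increasing if $\omega\in A$, $\sigma\in\{0,1\}^E$ and $\omega\le\sigma$ (coordinatewise) imply $\sigma\in A$. For $e\in E$, $\omega^{(e)}$ is obtained from $\omega$ by replacing $\omega_e$ by $1-\omega_e$. The element $e$ is pivotal (w.r.t. $\omega$ and $A$) if exactly one of $\omega,\omega^{(e)}$ is in $A$, and $0$-pivotal if it is pivotal and $\omega_e=0$. $I(e)=I^A_{k,E}(e)$ denotes the probability under $P_{k,E}$ that $e$ is $0$-pivotal w.r.t. $A$. A decision tree on $E$ is a pair $T=(e_1,\phi)$ with $e_1\in E$ and $\phi=(\phi_2,\dots,\phi_n)$, where each $\phi_t$ is a function which assigns to each pair $\left((e_1,\dots,e_{t-1}),\,\omega_{(e_1,\dots,e_{t-1})}\right)$ (a sequence of $t-1$ distinct elements of $E$ together with $0$-$1$ values at these elements) an element $e_t\in E\setminus\{e_1,\dots,e_{t-1}\}$. Given $\omega\in\{0,1\}^E$, the tree examines first $e_1$, and then inductively $e_t=\phi_t\bigl((e_1,\dots,e_{t-1}),(\omega_{e_1},\dots,\omega_{e_{t-1}})\bigr)$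 for $t=2,\dots,n$. With $e_{[t]}=\{e_1,\dots,e_t\}$, define $$\tau(\omega)=\min\{t\ge 1:\ \text{for all }\omega'\in\{0,1\}^E\text{ with }\omega'_{e_{[t]}}=\omega_{e_{[t]}},\ I_A(\omega')=I_A(\omega)\},$$ where $\omega_{e_{[t]}}$ denotes the restriction of $\omega$ to $e_{[t]}$. The revealment probability of $e\in E$ is $\delta_e=\delta_e(A,T)=P_{k,E}\bigl(e_t=e\text{ for some }t\le\tau(\omega)\bigr)$. *)

(* Defs.v *)
From HB Require Import structures.
From mathcomp Require Import all_boot all_order all_algebra.
From mathcomp Require Import reals.

Set Implicit Arguments.
Unset Strict Implicit.
Unset Printing Implicit Defensive.

Import Order.TTheory GRing.Theory Num.Theory.
Local Open Scope ring_scope.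

Notation config E := {ffun E -> bool}.

Section Events.
Variable E : finType.
Implicit Types (A : {set config E}) (w : config E) (e : E).

Definition weight w : nat := (\sum_(e : E) w e)%N.

Definition increasing A : Prop :=
  forall w s : config E, w \in A -> (forall e, (w e <= s e)%N) -> s \in A.

Definition flip w e : config E :=
  [ffun x => if x == e then ~~ w x else w x].

Definition pivotal A w e : bool := (w \in A) (+) (flip w e \in A).

Definition pivotal0 A w e : bool := pivotal A w e && (w e == false).

End Events.

(* The functions phi_2, ..., phi_n are gathered in one function on histories   *)
(* [:: (e_1, b_1); ...; (e_(t-1), b_(t-1))], phi_t being its restriction to     *)
(* histories of length t - 1. Its values on other sequences (empty, of length  *)
(* at least n, or with a repeated element) are irrelevant.                     *)
Record decision_tree (E : finType) := DecisionTree {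
  dt_root : E;
  dt_next : seq (E * bool) -> E;
  dt_nextP : forall h : seq (E * bool),
    uniq (unzip1 h) -> (0 < size h < #|E|)%N -> dt_next h \notin unzip1 h
}.

Section Exploration.
Variables (E : finType) (T : decision_tree E).
Implicit Types (A : {set config E}) (w : config E) (h : seq (E * bool)).

Definition dt_query h : E := if h is [::] then dt_root T else dt_next T h.

(* [:: (e_1, w e_1); ...; (e_t, w e_t)]; meaningful for t <= n only. *)
Fixpoint dt_history w (t : nat) : seq (E * bool) :=
  if t is t'.+1 then
    let h := dt_history w t' in
    let e := dt_query h in rcons h (e, w e)
  else [::].

(* The set e_[t] = {e_1, ..., e_t}. *)
Definition examined w (t : nat) : {set E} :=
  [set e in unzip1 (dt_history w t)].

Definition determined A w (t : nat) : bool :=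
  [forall w' : config E,
    [forall e in examined w t, w' e == w e] ==> ((w' \in A) == (w \in A))].

Lemma size_dt_history w t : size (dt_history w t) = t.
Proof. by elim: t => //= t IHt; rewrite size_rcons IHt. Qed.

Lemma uniq_dt_history w t :
  (t <= #|E|)%N -> uniq (unzip1 (dt_history w t)).
Proof.
elim: t => //= t IHt lt_tn; have Uh := IHt (ltnW lt_tn).
rewrite /unzip1 map_rcons rcons_uniq -/(unzip1 _) Uh andbT /=.
have := size_dt_history w t; rewrite /dt_query.
case Dh: (dt_history w t) => [//|x h] sz_h.
by rewrite -Dh; apply: dt_nextP; rewrite // Dh sz_h lt_tn -sz_h.
Qed.

Lemma examined_all w : examined w #|E| = [set: E].
Proof.
apply/eqP; rewrite eqEcard subsetT cardsT /= cardsE.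
by rewrite (card_uniqP (uniq_dt_history w (leqnn _))) size_map size_dt_history.
Qed.

Lemma exists_determined A w : exists t, (1 <= t)%N && determined A w t.
Proof.
exists #|E|; apply/andP; split; first by apply/card_gt0P; exists (dt_root T).
apply/forallP => w'; apply/implyP => /forallP eq_w.
suff -> : w' = w by [].
by apply/ffunP => e; apply/eqP; have := eq_w e; rewrite examined_all in_setT.
Qed.

Definition tau A w : nat := ex_minn (exists_determined A w).

End Exploration.

Section Probability.
Variables (R : realType) (E : finType) (k : nat).
Implicit Types (A : {set config E}) (T : decision_tree E) (e : E).

Definition pmf (w : config E) : R :=
  if weight w == k then 'C(#|E|, k)%:R^-1 else 0.

Definition prob A : R := \sum_(w in A) pmf w.

Definition influence A e : R := prob [set w | pivotal0 A w e].

Definition revealment A T e : R :=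
  prob [set w | e \in examined T w (tau T A w)].

Definition mean_revealment A T : R :=
  #|E|%:R^-1 * \sum_(e : E) revealment A T e.

End Probability.

(* Main.v *)
(* Write f for the indicator of A and p for its mean. Swapping the values at
   e_1 and at j_1 uniform in E, then at e_2 and at j_2 uniform outside
   {e_1}, ..., then at e_t and at j_t uniform outside {e_1, ..., e_(t-1)},
   turns the configuration w into some Y_t that is independent of the
   history at time t: the averaging operators of these swaps commute and are
   self-adjoint, and in the reversed order each of them removes the
   dependence on one explored coordinate. Since f(w) is known at time tau,
   p(1 - p) = E[f(w) (f(Y_0) - f(Y_tau))]. The step from Y_(t-1) to Y_t is a
   swap of e_t and j_t, and it makes f drop with probability at most I(e_t)
   + (average of I over the unexplored elements). For t <= n/2 this average
   is at most twice the global one; on tau > n/2 the remaining drop is at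
   most p(1 - p) in conditional mean, and p(1 - p) <= 2 sum_e I(e) follows
   from the same recursion for the tree that explores E in decreasing order
   of influence. This gives the constant 6 for all k and n. *)

Require Import Defs.
From HB Require Import structures.
From mathcomp Require Import all_boot all_order all_algebra.
From mathcomp Require Import all_fingroup reals.
From mathcomp Require Import zify ring.

Set Implicit Arguments.
Unset Strict Implicit.
Unset Printing Implicit Defensive.

Import Order.TTheory GRing.Theory Num.Theory.
Local Open Scope ring_scope.

(** * Averaging operators for random swaps of coordinates *)

Section Walk.
Variables (R : realType) (E : finType).
Implicit Types (w : config E) (e x : E) (p q : {perm E}) (X s : seq E).
Implicit Types (g h : config E -> R).

Definition permute p w : config E := [ffun x => w (p x)].

Lemma permuteM p q w : permute p (permute q w) = permute (p * q) w.
Proof. by apply/ffunP=> x; rewrite !ffunE permM. Qed.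

Lemma permuteK p : cancel (permute p) (permute p^-1).
Proof. by move=> w; apply/ffunP=> x; rewrite !ffunE permKV. Qed.

Lemma permuteKV p : cancel (permute p^-1) (permute p).
Proof. by move=> w; apply/ffunP=> x; rewrite !ffunE permK. Qed.

Lemma swapK e x : involutive (permute (tperm e x)).
Proof. by move=> w; rewrite -{1}tpermV permuteK. Qed.

Lemma weight_permute p w : weight (permute p w) = weight w.
Proof.
rewrite /weight [RHS](reindex_perm p) /=.
by apply: eq_bigr => x _; rewrite ffunE.
Qed.

Definition swap_avg e X h w : R :=
  #|[predC X]|%:R^-1 * \sum_(j | j \notin X) h (permute (tperm e j) w).

(** Expected value of [h] at the end of the swaps started from [w]: [X] holds the positions already
    treated, which no later swap may choose as a partner. The first swap is the outermost
    operator. *)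
Fixpoint walk X s h : config E -> R :=
  if s is e :: s' then swap_avg e X (walk (rcons X e) s' h) else h.

Lemma eq_swap_avg e X h g : h =1 g -> swap_avg e X h =1 swap_avg e X g.
Proof. by move=> hg w; congr (_ * _); apply: eq_bigr => j _; apply: hg. Qed.

Lemma swap_avg2 e e' X Y h w :
  swap_avg e X (swap_avg e' Y h) w =
    #|[predC X]|%:R^-1 * #|[predC Y]|%:R^-1 *
    \sum_(j | j \notin X) \sum_(j' | j' \notin Y)
       h (permute (tperm e' j' * tperm e j)%g w).
Proof.
rewrite /swap_avg -mulr_sumr mulrA; congr (_ * _).
by apply: eq_bigr => j _; apply: eq_bigr => j' _; rewrite permuteM.
Qed.

(* Conjugating [tperm e j] by [tperm e' j'] only permutes the indices [j] that
   are outside [X]. *)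
Lemma swap_avgC e e' X Y h : {subset X <= Y} -> e \in Y -> e' \notin Y ->
  swap_avg e X (swap_avg e' Y h) =1 swap_avg e' Y (swap_avg e X h).
Proof.
move=> sXY eY e'Y w; rewrite !swap_avg2 exchange_big /=.
rewrite [_^-1 * _ in RHS]mulrC; congr (_ * _); apply: eq_bigr => j' j'Y.
have fixY x : x \in Y -> tperm e' j' x = x.
  by move=> xY; rewrite tpermD //; apply: contraTneq xY => <-.
rewrite (reindex_inj (@perm_inj _ (tperm e' j'))) /=.
apply: eq_big => [j|j _].
  case: (boolP (j \in X)) => [jX|jX]; first by rewrite fixY ?jX // sXY.
  apply/negP => /[dup] jX' /sXY /fixY; rewrite tpermK => jj.
  by move: jX' jX; rewrite -jj => ->.
congr (h (permute _ _)).
by rewrite -{1}(fixY _ eY) -tpermJ conjgE tpermV !mulgA tperm2 mul1g.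
Qed.

(** Histories grow at their end, so a new query adds an innermost operator. *)
Lemma walk_rcons X s e h :
  walk X (rcons s e) h = walk X s (swap_avg e (X ++ s) h).
Proof.
by elim: s X => [|x s IHs] X /=; rewrite ?cats0 // IHs -cats1 -catA.
Qed.

(** The partner sets shrink along the walk, so [swap_avgC] lets the last average pass each earlier
    one in turn. *)
Lemma walk_swap_avg X s e h : uniq (rcons s e) -> e \notin X ->
  walk X s (swap_avg e (X ++ s) h) =1 swap_avg e (X ++ s) (walk X s h).
Proof.
elim: s X => [|x s IHs] X //=; rewrite mem_rcons inE negb_or.
case/andP=> /andP[xe xs] Us eX w.
rewrite -cat_rcons -swap_avgC; first 1 last.
- by move=> y yX; rewrite mem_cat mem_rcons inE yX orbT.
- by rewrite mem_cat mem_rcons inE eqxx.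
- move: Us; rewrite rcons_uniq mem_cat mem_rcons inE => /andP[es _].
  by rewrite !negb_or eq_sym xe eX es.
apply: eq_swap_avg => v; apply: IHs => //.
by rewrite mem_rcons inE negb_or eq_sym xe.
Qed.

Lemma walk_leD X s h h1 h2 : (forall w, h w <= h1 w + h2 w) ->
  forall w, walk X s h w <= walk X s h1 w + walk X s h2 w.
Proof.
move=> hle; elim: s X => [|e s IHs] X w //=.
rewrite /swap_avg -mulrDr -big_split /= ler_wpM2l ?invr_ge0 ?ler0n //.
by apply: ler_sum => j _; apply: IHs.
Qed.

Lemma walk_ge0 X s h : (forall w, 0 <= h w) -> forall w, 0 <= walk X s h w.
Proof.
move=> h0; elim: s X => [|e s IHs] X w //=.
by rewrite mulr_ge0 ?invr_ge0 ?ler0n // sumr_ge0.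
Qed.

(** As [e] itself is an admissible partner, the average is over a nonempty set. *)
Lemma swap_avg_const e X (c : R) w : e \notin X ->
  swap_avg e X (fun=> c) w = c.
Proof.
move=> eX; rewrite /swap_avg sumr_const -[X in _ * X]mulr_natl mulrA mulVf ?mul1r //.
by rewrite pnatr_eq0 -lt0n; apply/card_gt0P; exists e.
Qed.

Lemma walk_const X s (c : R) w : uniq s -> ~~ has (mem X) s ->
  walk X s (fun=> c) w = c.
Proof.
elim: s X w => [|e s IHs] X w //=; rewrite negb_or.
move=> /andP[es Us] /andP[eX sX].
rewrite -[RHS](swap_avg_const c w eX); apply: eq_swap_avg => v.
apply: IHs => //; apply/hasPn => x xs; rewrite /= mem_rcons inE negb_or.
by rewrite (hasPn sX) // andbT; apply: contraNneq es => <-.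
Qed.

(** * Expectation under the uniform law on the slice of weight [k] *)

Variable k : nat.

Definition Ex h : R := \sum_w pmf R k w * h w.

Lemma pmf_ge0 w : 0 <= pmf R k w.
Proof. by rewrite /pmf; case: ifP; rewrite ?invr_ge0 ?ler0n. Qed.

Lemma pmf_permute p w : pmf R k (permute p w) = pmf R k w.
Proof. by rewrite /pmf weight_permute. Qed.

Lemma eq_Ex g h : (forall w, weight w = k -> g w = h w) -> Ex g = Ex h.
Proof.
move=> gh; apply: eq_bigr => w _; rewrite /pmf.
by case: eqP => [/gh->|]; rewrite ?mul0r.
Qed.

Lemma ler_Ex g h : (forall w, g w <= h w) -> Ex g <= Ex h.
Proof. by move=> gh; apply: ler_sum => w _; rewrite ler_wpM2l ?pmf_ge0. Qed.

Lemma ExD g h : Ex (fun w => g w + h w) = Ex g + Ex h.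
Proof. by rewrite -big_split; apply: eq_bigr => w _; rewrite mulrDr. Qed.

Lemma ExZ (c : R) h : Ex (fun w => c * h w) = c * Ex h.
Proof. by rewrite mulr_sumr; apply: eq_bigr => w _; rewrite mulrCA. Qed.

Lemma Ex_sum (I : Type) (r : seq I) (P : pred I) (F : I -> config E -> R) :
  Ex (fun w => \sum_(i <- r | P i) F i w) = \sum_(i <- r | P i) Ex (F i).
Proof.
by rewrite exchange_big; apply: eq_bigr => w _; rewrite mulr_sumr.
Qed.

Lemma Ex_permute p h : Ex (fun w => h (permute p w)) = Ex h.
Proof.
rewrite [RHS](reindex (permute p)) /=; last first.
  by exists (permute p^-1) => w _; rewrite ?permuteK ?permuteKV.
by apply: eq_bigr => w _; rewrite pmf_permute.
Qed.

Lemma Ex_indicator (A : {set config E}) : Ex (fun w => (w \in A)%:R) = prob R k A.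
Proof.
rewrite /prob big_mkcond; apply: eq_bigr => w _.
by case: ifP; rewrite ?mulr1 ?mulr0.
Qed.

(** Self-adjointness: each swap is an involution that preserves the law. *)
Lemma Ex_swap_avg e X g h :
  Ex (fun w => swap_avg e X h w * g w) = Ex (fun w => h w * swap_avg e X g w).
Proof.
rewrite /swap_avg.
transitivity (#|[predC X]|%:R^-1 *
    \sum_(j | j \notin X) Ex (fun w => h (permute (tperm e j) w) * g w)).
  rewrite -Ex_sum -ExZ; apply: eq_bigr => w _; rewrite -mulrA mulr_suml.
  by congr (_ * (_ * _)).
transitivity (#|[predC X]|%:R^-1 *
    \sum_(j | j \notin X) Ex (fun w => h w * g (permute (tperm e j) w))).
  congr (_ * _); apply: eq_bigr => j _; rewrite -[RHS](Ex_permute (tperm e j)).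
  by apply: eq_bigr => w _; rewrite swapK.
rewrite -Ex_sum -ExZ; apply: eq_bigr => w _; congr (_ * _).
by rewrite -mulr_sumr mulrCA.
Qed.

(** * Independence of the swapped configuration from the explored values *)

Hypothesis kE : (k <= #|E|)%N.

Lemma weight_card w : weight w = #|[set e | w e]|.
Proof.
by rewrite -sum1dep_card big_mkcond; apply: eq_bigr => e _; case: (w e).
Qed.

Lemma Ex_const (c : R) : Ex (fun=> c) = c.
Proof.
suff S1 : \sum_(w : config E) pmf R k w = 1 :> R by rewrite /Ex -mulr_suml S1 mul1r.
rewrite -big_mkcond /= sumr_const -[X in X = _]mulr_natl.
rewrite (_ : #|_| = 'C(#|E|, k)) ?mulfV ?pnatr_eq0 -?lt0n ?bin_gt0 //.
rewrite -card_draws.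
pose F (B : {set E}) : config E := [ffun e => e \in B].
have injF : injective F.
  by move=> B C /ffunP BC; apply/setP=> e; have := BC e; rewrite !ffunE.
have supF w : F [set e | w e] = w by apply/ffunP=> e; rewrite ffunE inE.
rewrite -(card_imset _ injF); apply: eq_card => w; rewrite unfold_in.
apply/idP/imsetP => [wk|[B]].
  by exists [set e | w e]; rewrite ?inE -?weight_card ?supF.
rewrite inE weight_card => /eqP<- ->; apply/eqP/eq_card => e.
by rewrite inE ffunE.
Qed.

(** The weight fixes the number of ones, hence of zeros, on all of [E]; the common part on [s] is
    then subtracted. *)
Lemma card_outside w w' s b : weight w = weight w' -> {in s, w =1 w'} ->
  (\sum_(j | (j \notin s) && (w j == b)) 1 =
   \sum_(j | (j \notin s) && (w' j == b)) 1)%N.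
Proof.
move=> ww sww; have bww : (\sum_(j | w j == b) 1 = \sum_(j | w' j == b) 1)%N.
  move: ww; rewrite !weight_card !sum1dep_card; case: b => ww.
    by rewrite (eq_card (B := [set e | w e])) ?ww; [apply: eq_card|] => j;
      rewrite !inE eqb_id.
  apply/(@addnI #|[set e | w e]|); rewrite {2}ww.
  suff C (v : config E) : (#|[set e | v e]| + #|[set j | v j == false]| = #|E|)%N.
    by rewrite !C.
  rewrite -(cardsC [set e | v e]); congr addn; apply: eq_card => j.
  by rewrite !inE eqbF_neg.
move: bww; rewrite (bigID (mem s)) /= [RHS](bigID (mem s)) /=.
rewrite (eq_bigl (fun j => (w' j == b) && (j \in s))) => [/addnI|j].
  rewrite (eq_bigl (fun j => (j \notin s) && (w j == b))) => [->|j].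
    by apply: eq_bigl => j; rewrite andbC.
  by rewrite andbC.
by case: (boolP (j \in s)) => [/sww->|]; rewrite ?andbF.
Qed.

(* The values on [s] and the weight determine how many of the candidate swaps
   bring a given value to [e]. *)
Lemma swap_avg_local e s g : e \notin s ->
  (forall w w', weight w = k -> weight w' = k -> {in rcons s e, w =1 w'} ->
     g w = g w') ->
  forall w w', weight w = k -> weight w' = k -> {in s, w =1 w'} ->
     swap_avg e s g w = swap_avg e s g w'.
Proof.
move=> es gP w w' wk w'k ww; congr (_ * _).
have swapE (v : config E) j x : j \notin s -> x \in rcons s e ->
    permute (tperm e j) v x = if x == e then v j else v x.
  move=> js; rewrite ffunE mem_rcons inE; case: eqP => [->|/eqP xe xs].
    by rewrite tpermL.
  rewrite tpermD // 1?eq_sym //; apply: contraNneq js => <-.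
  exact: xs.
(* On [rcons s e] the swapped configuration is fixed by the values on [s] and the value that [j]
   brings to [e]. *)
have gE j j' : j \notin s -> j' \notin s -> w j = w' j' ->
    g (permute (tperm e j) w) = g (permute (tperm e j') w').
  move=> js j's wj; apply: gP => [||x xse]; rewrite ?weight_permute //.
  rewrite !swapE // wj; case: eqP => // /eqP xe; apply: ww.
  by move: xse; rewrite mem_rcons inE (negPf xe).
(* Candidates are grouped by the value brought to [e]: [g] is constant on each group, and the group
   sizes agree for [w] and [w']. *)
rewrite (partition_big w xpredT) // [RHS](partition_big w' xpredT) //=.
apply: eq_bigr => b _.
have Cb := card_outside b (etrans wk (esym w'k)) ww.
have [j0 /andP[j0s /eqP j0b]|none] :=
  pickP [pred j | (j \notin s) && (w j == b)].
  have const j : (j \notin s) && (w' j == b) ->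
      g (permute (tperm e j) w') = g (permute (tperm e j0) w) * 1%:R.
    by case/andP=> js /eqP jb; rewrite mulr1; apply: esym; apply: gE; rewrite ?j0b ?jb.
  rewrite [RHS](eq_bigr _ const).
  have [j1 /andP[j1s /eqP j1b]|none] :=
    pickP [pred j | (j \notin s) && (w' j == b)].
    rewrite (eq_bigr (fun=> g (permute (tperm e j0) w) * 1%:R)).
      by rewrite -!mulr_sumr -!natr_sum Cb.
    move=> j /andP[js /eqP jb].
    by rewrite -(const j1) ?j1s ?j1b ?eqxx //; apply: gE; rewrite ?jb ?j1b.
  move: Cb; rewrite [in RHS](eq_bigl _ _ none) big_pred0_eq => /eqP; rewrite sum_nat_eq0.
  by move/forallP/(_ j0); rewrite j0s j0b eqxx.
rewrite (eq_bigl _ _ none) big_pred0_eq.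
move: Cb; rewrite (eq_bigl _ _ none) big_pred0_eq => /esym/eqP.
rewrite sum_nat_eq0 => /forallP C.
by rewrite big_pred0 // => j; have := C j; case: (_ && _).
Qed.

(** The last average is moved outside and then onto [g], where it removes the dependence on the last
    coordinate, so that the induction hypothesis applies. Adjointness against the constant 1 shows
    that it keeps the mean of [g]. *)
Lemma walk_indep s h g : uniq s ->
  (forall w w', weight w = k -> weight w' = k -> {in s, w =1 w'} ->
     g w = g w') ->
  Ex (fun w => walk [::] s h w * g w) = Ex h * Ex g.
Proof.
elim/last_ind: s g => [|s e IHs] g Us gP /=.
  have [w0 w0k] : exists w0 : config E, weight w0 = k.
    have : (0 < #|[set B : {set E} | #|B| == k]|)%N by rewrite card_draws bin_gt0.
    case/card_gt0P=> B; rewrite inE => /eqP<-; exists [ffun e => e \in B].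
    by rewrite weight_card; apply: eq_card => e; rewrite inE ffunE.
  have gc w : weight w = k -> g w = g w0 by move=> wk; apply: gP.
  rewrite (eq_Ex (h := fun w => g w0 * h w)); last first.
    by move=> w /gc->; rewrite mulrC.
  by rewrite ExZ (eq_Ex gc) Ex_const mulrC.
have := Us; rewrite rcons_uniq => /andP[es Us'].
rewrite walk_rcons (eq_Ex (h := fun w => swap_avg e s (walk [::] s h) w * g w)).
  rewrite Ex_swap_avg IHs //; last exact: swap_avg_local.
  congr (_ * _); transitivity (Ex (fun w => 1 * swap_avg e s g w)).
    by apply: eq_Ex => w _; rewrite mul1r.
  by rewrite -Ex_swap_avg; apply: eq_Ex => w _; rewrite swap_avg_const ?mul1r.
by move=> w _; congr (_ * _); apply: (@walk_swap_avg [::]).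
Qed.

End Walk.

(** * The stopping time [tau] in terms of histories *)

Section Stopping.
Variables (E : finType) (T : decision_tree E).
Implicit Types (A : {set config E}) (w : config E).

Lemma in_examined w u e : (e \in examined T w u) = (e \in unzip1 (dt_history T w u)).
Proof. by rewrite inE. Qed.

Lemma dt_historyS w u : unzip1 (dt_history T w u.+1) =
  rcons (unzip1 (dt_history T w u)) (dt_query T (dt_history T w u)).
Proof. by rewrite /unzip1 /= map_rcons. Qed.

(** Each query is a function of the earlier answers, so the two explorations coincide step by
    step. *)
Lemma dt_history_local w w' u :
  {in unzip1 (dt_history T w u), w =1 w'} -> dt_history T w u = dt_history T w' u.
Proof.
elim: u => // u IHu; rewrite dt_historyS => ww /=.
rewrite -IHu => [|e eu]; last by apply: ww; rewrite mem_rcons inE eu orbT.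
by rewrite ww // mem_rcons inE eqxx.
Qed.

Lemma dt_history_agree w w' u : dt_history T w u = dt_history T w' u ->
  {in unzip1 (dt_history T w u), w =1 w'}.
Proof.
elim: u => // u IHu /= /rcons_inj[hh [_ ww]] e.
rewrite /unzip1 map_rcons mem_rcons inE => /orP[/eqP->|]; last exact: IHu.
by rewrite /= ww -hh.
Qed.

Lemma dt_history_le w w' u v : (v <= u)%N ->
  dt_history T w u = dt_history T w' u -> dt_history T w v = dt_history T w' v.
Proof.
move=> /subnK <-; elim: (u - v)%N => //= d IHd.
by case/rcons_inj=> /IHd.
Qed.

Lemma determined_agree A w w' u : determined T A w u ->
  dt_history T w u = dt_history T w' u -> (w' \in A) = (w \in A).
Proof.
move=> /forallP/(_ w')/implyP det hh; apply/eqP/det/forallP => e.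
by apply/implyP; rewrite in_examined => eh; rewrite (dt_history_agree hh).
Qed.

Lemma determined_hist A w w' u : dt_history T w u = dt_history T w' u ->
  determined T A w u -> determined T A w' u.
Proof.
move=> hh det; apply/forallP => v; apply/implyP => /forallP vw'.
have hv : dt_history T w u = dt_history T v u.
  rewrite hh; apply: dt_history_local => e ew'; apply/esym/eqP.
  by have := vw' e; rewrite in_examined ew'.
by rewrite (determined_agree det hv) (determined_agree det hh).
Qed.

Lemma tau_gt0 A w : (0 < tau T A w)%N.
Proof. by rewrite /tau; case: ex_minnP => t /andP[]. Qed.

Lemma tau_determined A w : determined T A w (tau T A w).
Proof. by rewrite /tau; case: ex_minnP => t /andP[]. Qed.

Lemma tau_min A w u : (0 < u)%N -> determined T A w u -> (tau T A w <= u)%N.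
Proof. by move=> u0 du; rewrite /tau; case: ex_minnP => t _; apply; rewrite u0. Qed.

Lemma tau_le_card A w : (tau T A w <= #|E|)%N.
Proof.
apply: tau_min; first by apply/card_gt0P; exists (dt_root T).
apply/forallP => w'; apply/implyP => /forallP ww; rewrite (_ : w' = w) //.
by apply/ffunP => e; apply/eqP; have := ww e; rewrite examined_all inE.
Qed.

Lemma tau_le_hist A w w' u : dt_history T w u = dt_history T w' u ->
  (tau T A w <= u)%N -> (tau T A w' <= tau T A w)%N.
Proof.
move=> hh tu; apply: tau_min; first exact: tau_gt0.
exact: (determined_hist (dt_history_le tu hh) (tau_determined A w)).
Qed.

(** [tau] is a stopping time, because being determined is a property of the history alone. *)
Lemma lt_tau_hist A w w' u : dt_history T w u = dt_history T w' u ->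
  (u < tau T A w)%N = (u < tau T A w')%N.
Proof.
move=> hh; rewrite !ltnNge; congr (~~ _); apply/idP/idP => tu.
  exact: leq_trans (tau_le_hist hh tu) tu.
exact: leq_trans (tau_le_hist (esym hh) tu) tu.
Qed.

Lemma tau_agree A w w' u : dt_history T w u = dt_history T w' u ->
  (tau T A w <= u)%N -> (w' \in A) = (w \in A).
Proof.
move=> hh tu.
exact: (determined_agree (tau_determined A w) (dt_history_le tu hh)).
Qed.

Lemma dt_query_fresh w u : (u < #|E|)%N ->
  dt_query T (dt_history T w u) \notin unzip1 (dt_history T w u).
Proof.
by move/(uniq_dt_history T w); rewrite dt_historyS rcons_uniq => /andP[].
Qed.

Lemma sum_examined (V : nmodType) (F : E -> V) w u : (u <= #|E|)%N ->
  \sum_(e in examined T w u) F e =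
  \sum_(v < u) F (dt_query T (dt_history T w v)).
Proof.
move=> uE; rewrite (eq_bigl _ _ (in_examined w u)).
rewrite -big_uniq ?uniq_dt_history //=; elim: u {uE} => [|u IHu].
  by rewrite big_nil big_ord0.
by rewrite dt_historyS big_rcons big_ord_recr /= IHu.
Qed.

Lemma card_examined w u : (u <= #|E|)%N -> #|examined T w u| = u.
Proof.
by move=> uE; rewrite -sum1_card sum_examined // sum_nat_const card_ord muln1.
Qed.

End Stopping.

(** * Swaps along the explored history and the loss at one swap *)

Section Inequality.
Variables (R : realType) (E : finType) (k : nat) (A : {set config E}).
Hypotheses (kE : (k <= #|E|)%N) (incA : increasing A).
Implicit Types (T : decision_tree E) (w : config E) (e j : E) (X : seq E).

Local Notation Ex := (@Ex R E k).
Local Notation I := (influence R k A).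
Local Notation p := (prob R k A).
Let ind w : R := (w \in A)%:R.

(** Here the walk follows a random list. Splitting by the value [t] of the history fixes that list,
    and [g] times the indicator of [H w = t] depends only on the coordinates queried in [t], so
    [walk_indep] applies. *)
Lemma Ex_history T u (g : config E -> R) (h : seq (E * bool) -> config E -> R) :
  (u <= #|E|)%N ->
  (forall w w', dt_history T w u = dt_history T w' u -> g w = g w') ->
  Ex (fun w => walk [::] (unzip1 (dt_history T w u)) (h (dt_history T w u)) w * g w)
    = Ex (fun w => Ex (h (dt_history T w u)) * g w).
Proof.
move=> uE gP; pose H w : u.-tuple (E * bool) :=
  Tuple (introT eqP (size_dt_history T w u)).
rewrite /Ex [LHS](partition_big H xpredT) // [RHS](partition_big H xpredT) //=.
apply: eq_bigr => t _.
pose gt w := g w * (H w == t)%:R.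
transitivity (Ex (fun w => walk [::] (unzip1 t) (h t) w * gt w)).
  rewrite big_mkcond; apply: eq_bigr => w _; rewrite /gt.
  by case: eqP => [<-|_]; rewrite ?mulr1 ?mulr0.
transitivity (Ex (fun w => Ex (h t) * gt w)); last first.
  rewrite [RHS]big_mkcond; apply: eq_bigr => w _; rewrite /gt.
  by case: eqP => [<-|_]; rewrite ?mulr1 ?mulr0.
(* If no configuration produces [t], both sides vanish; otherwise [t] inherits distinct queries from
   [w0]. *)
have [w0 /eqP w0t|none] := pickP [pred w | H w == t]; last first.
  apply: eq_Ex => w _; have nw : (H w == t) = false := none w.
  by rewrite /gt nw !mulr0.
have {w0t} tE : t = dt_history T w0 u :> seq _ by rewrite -w0t.
have HE w : (H w == t) = (dt_history T w u == t) by [].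
rewrite ExZ walk_indep //; first by rewrite tE uniq_dt_history.
move=> w w' _ _ ww; rewrite /gt !HE tE.
rewrite {}tE in ww *; case: eqP => [hw|nhw].
  have hw' : dt_history T w u = dt_history T w' u.
    by apply: dt_history_local; rewrite hw.
  by rewrite -hw' hw eqxx (gP _ _ hw').
case: eqP => [hw'|]; last by rewrite !mulr0.
case: nhw; rewrite -hw'; apply/esym/dt_history_local; rewrite hw'.
by move=> e /ww.
Qed.

(** Probability, over the random partner [j], that the swap at [e] throws [w] out of [A]. *)
Definition drop_avg e X w : R :=
  #|[predC X]|%:R^-1 *
  \sum_(j | j \notin X) ((w \in A) && (permute (tperm e j) w \notin A))%:R.

Lemma drop_avg_ge0 e X w : 0 <= drop_avg e X w.
Proof. by rewrite mulr_ge0 ?invr_ge0 ?ler0n // sumr_ge0. Qed.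

Definition pair_influence e X : R :=
  I e + #|[predC X]|%:R^-1 * \sum_(j | j \notin X) I j.

Lemma ind_le_drop e X w : e \notin X ->
  ind w <= swap_avg e X ind w + drop_avg e X w.
Proof.
move=> eX; rewrite -{1}(swap_avg_const (ind w) w eX) -mulrDr -big_split /=.
rewrite ler_wpM2l ?invr_ge0 ?ler0n //; apply: ler_sum => j _.
by rewrite /ind -natrD ler_nat; case: (w \in A); case: (_ \in A).
Qed.

(* The swap moves a 1 from one of the two positions to the other; putting it back
   without removing the new one gives a configuration above [w]. *)
Lemma drop_pivotal e j w : w \in A -> permute (tperm e j) w \notin A ->
  pivotal0 A (permute (tperm e j) w) e || pivotal0 A (permute (tperm e j) w) j.
Proof.
set v := permute _ w => wA vA.
have vE x : v x = w (tperm e j x) by rewrite ffunE.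
have ve : v e = w j by rewrite vE tpermL.
have vj : v j = w e by rewrite vE tpermR.
have vx x : x != e -> x != j -> v x = w x by move=> xe xj; rewrite vE tpermD // eq_sym.
have piv x : ~~ v x -> flip v x \in A -> pivotal0 A v x.
  by move=> vx0 fA; rewrite /pivotal0 /pivotal (negPf vA) fA (negPf vx0).
case we: (w e); case wj: (w j).
- suff vw : v = w by rewrite vw wA in vA.
  apply/ffunP=> x; case: (eqVneq x e) => [->|xe]; first by rewrite ve we wj.
  by case: (eqVneq x j) => [->|xj]; rewrite ?vj ?we ?wj ?vx.
- rewrite piv ?ve ?wj //; apply: incA wA _ => x; rewrite ffunE.
  case: (eqVneq x e) => [->|xe]; first by rewrite ve wj leq_b1.
  by case: (eqVneq x j) => [->|xj]; [rewrite wj | rewrite vx].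
- rewrite [X in _ || X]piv ?vj ?we ?orbT //; apply: incA wA _ => x; rewrite ffunE.
  case: (eqVneq x j) => [->|xj]; first by rewrite vj we leq_b1.
  by case: (eqVneq x e) => [->|xe]; [rewrite we | rewrite vx].
suff vw : v = w by rewrite vw wA in vA.
apply/ffunP=> x; case: (eqVneq x e) => [->|xe]; first by rewrite ve we wj.
by case: (eqVneq x j) => [->|xj]; rewrite ?vj ?we ?wj ?vx.
Qed.

Lemma influence_ge0 e : 0 <= I e.
Proof. by apply: sumr_ge0 => w _; apply: pmf_ge0. Qed.

(** By [drop_pivotal], a drop makes [e] or [j] 0-pivotal after the swap. The swap preserves the law,
    so a union bound gives [I e + I j], averaged over [j]. *)
Lemma Ex_drop e X : e \notin X -> Ex (drop_avg e X) <= pair_influence e X.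
Proof.
move=> eX; rewrite /drop_avg ExZ Ex_sum /pair_influence.
(* [I e] is put under the average over [j]; the configuration is a dummy argument. *)
rewrite -{1}(swap_avg_const (I e) [ffun=> true] eX) /swap_avg -mulrDr -big_split /=.
rewrite ler_wpM2l ?invr_ge0 ?ler0n //; apply: ler_sum => j _.
rewrite /influence -!Ex_indicator -ExD.
rewrite -[leRHS](Ex_permute _ (tperm e j)) /=.
apply: ler_Ex => w; rewrite !inE.
have := @drop_pivotal e j w.
case: (w \in A) => //=; last by rewrite -natrD ler0n.
case: (_ \notin A) => //=; last by rewrite -natrD ler0n.
by move/(_ isT isT) => piv; rewrite -natrD ler_nat; move: piv; do 2!case: pivotal0.
Qed.

(** * Telescoping along the exploration up to [tau] *)

Lemma prob_ge0 : 0 <= p.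
Proof. by apply: sumr_ge0 => w _; apply: pmf_ge0. Qed.

Lemma prob_le1 : p <= 1.
Proof.
rewrite -Ex_indicator -[leRHS](Ex_const kE); apply: ler_Ex => w.
by rewrite lern1 leq_b1.
Qed.

(** The part of [E[f(w) (f(Y_u) - p)]] that comes from runs still undecided after [u] queries. *)
Definition residual T u : R :=
  Ex (fun w => (u < tau T A w)%:R *
    (ind w * (walk [::] (unzip1 (dt_history T w u)) ind w - p))).

Lemma residual0 T : residual T 0 = p * (1 - p).
Proof.
rewrite /residual (eq_Ex (h := fun w => (1 - p) * ind w)).
  by rewrite ExZ Ex_indicator mulrC.
move=> w _; rewrite tau_gt0 mul1r /= /ind.
by case: (w \in A); rewrite ?mulr0 ?mul0r // mulr1 mul1r.
Qed.

(** One more swap costs at most the expected drop. The runs with [tau = u + 1] then leave the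
    residual for free: their verdict is a function of the history of length [u + 1], of which
    [Y_(u+1)] is independent. *)
Lemma residual_step T u : (u < #|E|)%N ->
  residual T u <=
    Ex (fun w => (u < tau T A w)%:R *
      pair_influence (dt_query T (dt_history T w u)) (unzip1 (dt_history T w u)))
    + residual T u.+1.
Proof.
move=> uE.
pose g w : R := (u < tau T A w)%:R.
pose h (H : seq (E * bool)) := drop_avg (dt_query T H) (unzip1 H).
(* The event [u < tau] is known from the history of length [u], so the drop after the walk may be
   replaced by its mean. *)
have gap : Ex (fun w => walk [::] (unzip1 (dt_history T w u)) (h (dt_history T w u)) w * g w)
    <= Ex (fun w => (u < tau T A w)%:R *
      pair_influence (dt_query T (dt_history T w u)) (unzip1 (dt_history T w u))).
  rewrite Ex_history ?(ltnW uE) //; last first.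
    by move=> w w' hh; rewrite /g (lt_tau_hist A hh).
  apply: ler_Ex => w; rewrite mulrC ler_wpM2l ?ler0n // Ex_drop //.
  exact: dt_query_fresh.
pose stop w : R := (tau T A w == u.+1)%:R * ind w.
have stopped : Ex (fun w =>
    (walk [::] (unzip1 (dt_history T w u.+1)) ind w - p) * stop w) = 0.
  rewrite (eq_Ex (h := fun w => walk [::] (unzip1 (dt_history T w u.+1)) ind w * stop w
      + (-1) * (Ex ind * stop w))); last first.
    by move=> w _; rewrite mulrBl mulN1r Ex_indicator.
  rewrite ExD ExZ (Ex_history (fun=> ind)) // ?mulN1r ?subrr //.
  move=> w w' hh; rewrite /stop /ind.
  have tt v : (tau T A v == u.+1) = (u < tau T A v)%N && ~~ (u.+1 < tau T A v)%N.
    by rewrite -leqNgt eqn_leq andbC.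
  rewrite !tt (lt_tau_hist A (dt_history_le (leqnSn u) hh)) (lt_tau_hist A hh).
  case: (boolP (u.+1 < _)%N); rewrite ?andbF ?mul0r // -leqNgt => tw.
  by rewrite (tau_agree hh) // leqNgt (lt_tau_hist A hh) -leqNgt.
rewrite -[leRHS]addr0 -stopped; apply: le_trans (lerD (lerD gap (lexx _)) (lexx _)).
rewrite -!ExD; apply: ler_Ex => w.
set W := walk _ _ ind w; set W' := walk _ (unzip1 (dt_history T w u.+1)) ind w.
set G := walk _ _ _ w.
have WW : W <= W' + G.
  rewrite /W' dt_historyS walk_rcons; apply: walk_leD => v.
  by apply: ind_le_drop; apply: dt_query_fresh.
have G0 : 0 <= G.
  by apply: walk_ge0 => v; apply: drop_avg_ge0.
rewrite /stop /g /ind.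
(* An undecided run either continues or stops at the next query. *)
rewrite (_ : (u < _)%N%:R =
  (u.+1 < tau T A w)%:R + (tau T A w == u.+1)%:R :> R); last first.
  by rewrite -natrD; congr _%:R; case: (ltngtP (tau T A w) u.+1).
case: (w \in A); rewrite ?mul1r ?mul0r ?mulr0 ?addr0; last first.
  by rewrite mulr_ge0 // addr_ge0.
have ab0 : 0 <= (u.+1 < tau T A w)%:R + (tau T A w == u.+1)%:R :> R.
  by rewrite addr_ge0.
have := ler_wpM2l ab0 (lerB WW (lexx p)).
by rewrite [true%:R]mulr1n; congr (_ <= _); ring.
Qed.

(** Pointwise [f <= p + (1 - p) f], so the walk of [f] exceeds [p] by at most the walk of
    [(1 - p) f], which is nonnegative and has mean [p (1 - p)] given the history. *)
Lemma residual_le T u : (u <= #|E|)%N ->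
  residual T u <= Ex (fun w => (u < tau T A w)%:R) * (p * (1 - p)).
Proof.
move=> uE; pose h w : R := (1 - p) * ind w.
have Eh : Ex h = p * (1 - p) by rewrite ExZ Ex_indicator mulrC.
have -> : Ex (fun w => (u < tau T A w)%:R) * (p * (1 - p)) =
    Ex (fun w => walk [::] (unzip1 (dt_history T w u)) h w * (u < tau T A w)%:R).
  rewrite (Ex_history (fun=> h)) //; last first.
    by move=> w w' hh; rewrite (lt_tau_hist A hh).
  by rewrite ExZ Eh mulrC.
apply: ler_Ex => w; rewrite mulrC ler_wpM2r ?ler0n //.
set W := walk _ _ ind w; set H := walk _ _ h w.
have h0 v : 0 <= h v by rewrite mulr_ge0 ?ler0n // subr_ge0 prob_le1.
have H0 : 0 <= H by apply: walk_ge0.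
have WH : W <= p + H.
  rewrite -[in leRHS](walk_const (X := [::]) p w (uniq_dt_history T w uE)).
    apply: walk_leD => v; rewrite /h /ind; case: (_ \in A).
      by rewrite mulr1 addrC subrK.
    by rewrite mulr0 addr0 prob_ge0.
  by apply/hasPn.
rewrite /ind; case: (_ \in A); rewrite ?mul1r ?mul0r //.
by rewrite lerBlDl.
Qed.

(** Cutting the recursion at [m] avoids the late swaps, whose few partners may have an average
    influence far above the global one. *)
Lemma variance_le_exploration T m : (m <= #|E|)%N ->
  p * (1 - p) <=
    \sum_(u < m) Ex (fun w => (u < tau T A w)%:R *
      pair_influence (dt_query T (dt_history T w u)) (unzip1 (dt_history T w u)))
    + Ex (fun w => (m < tau T A w)%:R) * (p * (1 - p)).
Proof.
move=> mE; rewrite -{1}(residual0 T).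
apply: le_trans (lerD (lexx _) (residual_le T mE)).
elim: m mE => [|m IHm] mE; first by rewrite big_ord0 add0r.
apply: le_trans (IHm (ltnW mE)) _.
by rewrite big_ord_recr /= -addrA lerD2l residual_step.
Qed.

End Inequality.

(** * A tree exploring [E] in decreasing order of a function *)

Section GreedyTree.
Variables (R : realType) (E : finType) (f : E -> R) (e0 : E).

(** The default [e0] is returned only when [h] lists all of [E]. *)
Definition greedy_next (h : seq (E * bool)) : E :=
  odflt e0 [pick e | (e \notin unzip1 h) &&
                     [forall j, (j \notin unzip1 h) ==> (f j <= f e)]].

Lemma greedy_nextP (h : seq (E * bool)) : (size h < #|E|)%N ->
  (greedy_next h \notin unzip1 h) /\
  (forall j, j \notin unzip1 h -> f j <= f (greedy_next h)).
Proof.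
move=> hE; rewrite /greedy_next; case: pickP => [e /andP[eh /forallP fe]|none].
  by split=> // j jh; have := fe j; rewrite jh.
have [e1 e1h] : exists e, e \notin unzip1 h.
  apply/existsP; apply: contraTT hE; rewrite negb_exists -leqNgt => /forallP all_h.
  rewrite -(size_map fst h) -(size_map id) map_id.
  apply: leq_trans (card_size (unzip1 h)).
  by apply/subset_leq_card/subsetP => e _; have := all_h e; rewrite negbK.
case: (arg_maxP (P := fun e => e \notin unzip1 h) f e1h) => e eh fe.
have /negP[] := none e; rewrite /= eh /=.
by apply/forallP => j; apply/implyP => /fe.
Qed.

Lemma greedy_tree : exists T : decision_tree E, forall (w : config E) u,
  (u < #|E|)%N -> forall j, j \notin unzip1 (dt_history T w u) ->
  f j <= f (dt_query T (dt_history T w u)).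
Proof.
have nextP h : uniq (unzip1 h) -> (0 < size h < #|E|)%N ->
    greedy_next h \notin unzip1 h.
  by move=> _ /andP[_ /greedy_nextP[]].
exists (DecisionTree (greedy_next [::]) nextP) => w u uE j.
set h := dt_history _ w u => jh.
have -> : dt_query (DecisionTree (greedy_next [::]) nextP) h = greedy_next h.
  by case: h {jh}.
by apply: (greedy_nextP _).2 jh; rewrite size_dt_history.
Qed.

End GreedyTree.

(** * From the exploration bound to revealments *)

Section Conclusion.
Variables (R : realType) (E : finType) (k : nat) (A : {set config E}).
Hypotheses (kE : (k <= #|E|)%N) (incA : increasing A).

Local Notation Ex := (@Ex R E k).
Local Notation I := (influence R k A).
Local Notation p := (prob R k A).

(** Both sums are padded to length [n] and then compared termwise. *)
Lemma sum_truncated (x : nat -> R) m t n : (m <= n)%N -> (t <= n)%N ->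
  (forall u, 0 <= x u) -> \sum_(u < m) (u < t)%:R * x u <= \sum_(u < t) x u.
Proof.
move=> mn tn x0; rewrite (big_ord_widen n (fun u => (u < t)%:R * x u)) //.
rewrite [leRHS](big_ord_widen n x) // big_mkcond [leRHS]big_mkcond /=.
by apply: ler_sum => u _; do 2!case: ltnP => _; rewrite ?mul1r ?mul0r.
Qed.

Lemma card_predC_uniq (s : seq E) : uniq s -> #|[predC s]| = (#|E| - size s)%N.
Proof. by move=> Us; rewrite -(cardC (mem s)) (card_uniqP Us) addKn. Qed.

(* Exploring in decreasing order of influence, every average influence of the
   unexplored elements is at most the influence of the element explored next. *)
Lemma variance_le_influence : (0 < #|E|)%N -> p * (1 - p) <= 2%:R * \sum_e I e.
Proof.
case/card_gt0P=> e0 _; have [T greedyT] := greedy_tree I e0.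
have := variance_le_exploration R kE incA T (leqnn #|E|).
(* [tau] never exceeds [#|E|], so the tail term vanishes. *)
rewrite [X in _ + X * _](eq_Ex (h := fun=> 0)) => [|w _]; last first.
  by rewrite ltnNge tau_le_card.
rewrite (Ex_const kE) mul0r addr0 => /le_trans; apply.
rewrite -Ex_sum -[leRHS](Ex_const kE); apply: ler_Ex => w.
have -> : \sum_e I e = \sum_(e in examined T w #|E|) I e.
  by rewrite examined_all; apply: eq_bigl => e; rewrite inE.
rewrite sum_examined // mulr_sumr; apply: ler_sum => u _.
have uE := ltn_ord u; set e := dt_query _ _; set X := unzip1 _.
have eX : e \notin X by apply: dt_query_fresh.
apply: (@le_trans _ _ (pair_influence R k A e X)).
  rewrite ler_piMl ?lern1 ?leq_b1 // addr_ge0 ?influence_ge0 // mulr_ge0 ?invr_ge0 //.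
  by apply: sumr_ge0 => j _; apply: influence_ge0.
rewrite mulr_natl mulr2n lerD2l -[leRHS](swap_avg_const (I e) w eX).
by rewrite ler_wpM2l ?invr_ge0 // ler_sum // => j jX; apply: greedyT.
Qed.

Lemma osss_slice (T : decision_tree E) :
  p * (1 - p) <= 6%:R * (\sum_e I e * revealment R k A T e +
                         \sum_e I e * mean_revealment R k A T).
Proof.
have n0 : (0 < #|E|)%N by apply/card_gt0P; exists (dt_root T).
pose n : R := #|E|%:R; have n0R : 0 < n by rewrite ltr0n.
pose c := \sum_e I e; have I0 e := influence_ge0 R k A e.
have c0 : 0 <= c by apply: sumr_ge0.
have rev0 e : 0 <= revealment R k A T e by apply: prob_ge0.
pose m := (#|E|./2)%N; have mE : (m <= #|E|)%N.
  by rewrite leq_half_double -addnn ltnW // ltnS leq_addr.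
have := variance_le_exploration R kE incA T mE.
set S := \sum_(u < m) _ => varS.
(* Here 6 = 2 + 4: a query in the first half costs at most an extra [2 c / n], and the tail, at most
   [2 c] on [m < tau], is charged to the [tau] queries at [4 c / n] each. *)
have {}varS : p * (1 - p) <= Ex (fun w =>
    \sum_(e in examined T w (tau T A w)) (I e + 6%:R * c / n)).
  apply: le_trans varS _.
  apply: le_trans (lerD (lexx _) (ler_wpM2l _ (variance_le_influence n0))) _.
    by rewrite -(Ex_const kE 0); apply: ler_Ex => w.
  rewrite [X in _ + X]mulrC -ExZ /S -Ex_sum -ExD; apply: ler_Ex => w.
  rewrite big_split /= sumr_const card_examined ?tau_le_card //.
  rewrite sum_examined ?tau_le_card //; set t := tau T A w.
  rewrite -[X in _ <= _ + X]mulr_natr; apply: (@le_trans _ _ (\sum_(u < m) (u < t)%:R *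
      (I (dt_query T (dt_history T w u)) + 2%:R * c / n) + 2%:R * c * (m < t)%:R)).
    rewrite lerD2r; apply: ler_sum => u _; rewrite ler_wpM2l // lerD2l.
    have um := ltn_ord u; have uE : (u < #|E|)%N by exact: leq_trans um mE.
    rewrite card_predC_uniq ?uniq_dt_history ?(ltnW uE) // size_map size_dt_history.
    rewrite -[2%:R * c / n]mulrAC ler_pM ?invr_ge0 ?sumr_ge0 //.
      (* For [u < m] at least half of [E] is unexplored. *)
      rewrite -[leLHS]mul1r ler_pdivrMr ?ltr0n ?subn_gt0 // mulrAC.
      by rewrite ler_pdivlMr // mul1r -natrM ler_nat; move: um; rewrite /m; lia.
    by rewrite /c [leRHS](bigID (mem (unzip1 (dt_history T w u)))) /= lerDr sumr_ge0.
  have -> : 6%:R * c / n * t%:R = t%:R * (2%:R * c / n) + 2%:R * c * (2%:R * t%:R / n).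
    by field; rewrite gt_eqF.
  rewrite addrA lerD //.
    have -> : t%:R * (2%:R * c / n) = \sum_(u < t) (2%:R * c / n).
      by rewrite sumr_const card_ord mulr_natl.
    rewrite -big_split /=.
    apply: (sum_truncated mE (tau_le_card T A w)
      (x := fun u => I (dt_query T (dt_history T w u)) + 2%:R * c / n)) => u.
    by rewrite addr_ge0 // !mulr_ge0 // invr_ge0 ltW.
  rewrite ler_wpM2l ?mulr_ge0 //; case: ltnP => mt; last first.
    by rewrite !mulr_ge0 // invr_ge0 ltW.
  (* [m < t] gives [n <= 2 t] despite the rounding in [m]. *)
  by rewrite ler_pdivlMr // mul1r -natrM ler_nat; move: mt; rewrite /m; lia.
apply: (le_trans varS).
(* Exchanging mean and sum turns the event that [e] is examined by time [tau] into its
   revealment. *)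
have -> : Ex (fun w => \sum_(e in examined T w (tau T A w)) (I e + 6%:R * c / n)) =
    \sum_e (I e + 6%:R * c / n) * revealment R k A T e.
  rewrite (eq_Ex (h := fun w => \sum_e (I e + 6%:R * c / n) *
      (w \in [set w | e \in examined T w (tau T A w)])%:R)).
    by rewrite Ex_sum; apply: eq_bigr => e _; rewrite ExZ Ex_indicator.
  move=> w _; rewrite big_mkcond; apply: eq_bigr => e _; rewrite [in RHS]inE.
  by case: (e \in _); rewrite ?mulr1 ?mulr0.
rewrite -mulr_suml -/c.
have -> : c * mean_revealment R k A T = c / n * \sum_e revealment R k A T e.
  by rewrite /mean_revealment mulrA.
under eq_bigr do rewrite mulrDl.
rewrite big_split /= -mulr_sumr mulrDr -!mulrA lerD2r.
(* Only the first sum still needs its coefficient raised from 1 to 6. *)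
rewrite ler_peMl ?ler1n // sumr_ge0 // => e _; exact: mulr_ge0.
Qed.

End Conclusion.
Theorem theorem1p1 (R : realType) :
  ((exists C : R,
      forall (E : finType) (A : {set config E}) (T : decision_tree E),
        (0 < #|E|)%N -> ~~ odd #|E| ->
        increasing A -> A != set0 -> A != [set: config E] ->
        let k := (#|E|./2)%N in
        prob R k A * (1 - prob R k A) <=
          C * (\sum_(e : E) influence R k A e * revealment R k A T e +
               \sum_(e : E) influence R k A e * mean_revealment R k A T))
   /\
   (forall (E : finType) (A : {set config E}) (T : decision_tree E),
      (10 <= #|E|)%N -> ~~ odd #|E| ->
      increasing A -> A != set0 -> A != [set: config E] ->
      let k := (#|E|./2)%N in
      prob R k A * (1 - prob R k A) <=
        20%:R * (\sum_(e : E) influence R k A e * revealment R k A T e +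
                 \sum_(e : E) influence R k A e * mean_revealment R k A T)))
  /\
  (forall eps : R, 0 < eps -> eps <= 2%:R^-1 ->
     exists C : R,
       forall (n : nat) (E : finType) (k : nat)
              (A : {set config E}) (T : decision_tree E),
         (0 < n)%N -> #|E| = n ->
         eps * n%:R <= k%:R -> k%:R <= (1 - eps) * n%:R ->
         increasing A -> A != set0 -> A != [set: config E] ->
         prob R k A * (1 - prob R k A) <=
           C * (\sum_(e : E) influence R k A e * revealment R k A T e +
                \sum_(e : E) influence R k A e * mean_revealment R k A T)).
Proof.
Proof.
(* One bound for every [k <= #|E|] serves both parts; 6 is raised to 20 since the sums are
   nonnegative. *)
have bound20 (E : finType) (A : {set config E}) (T : decision_tree E) (k : nat) :
    (k <= #|E|)%N -> increasing A ->
    prob R k A * (1 - prob R k A) <=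
      20%:R * (\sum_(e : E) influence R k A e * revealment R k A T e +
               \sum_(e : E) influence R k A e * mean_revealment R k A T).
  move=> kE incA; apply: le_trans (osss_slice R kE incA T) _.
  rewrite ler_wpM2r ?ler_nat // addr_ge0 // sumr_ge0 // => e _.
    by rewrite mulr_ge0 ?influence_ge0 ?prob_ge0.
  rewrite mulr_ge0 ?influence_ge0 // mulr_ge0 ?invr_ge0 // sumr_ge0 // => j _.
  exact: prob_ge0.
have half_le (E : finType) : (#|E|./2 <= #|E|)%N.
  by rewrite leq_half_double -addnn ltnW // ltnS leq_addr.
split; first split.
- by exists 20%:R => E A T _ _ incA _ _; apply: bound20.
- by move=> E A T _ _ incA _ _; apply: bound20.
move=> eps eps0 _; exists 20%:R => n E k A T n0 nE _ kn incA _ _.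
apply: bound20 => //; rewrite -(ler_nat R) nE (le_trans kn) //.
by rewrite ler_piMl // gerBl ltW.
Qed.
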